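(* Let $\lambda>0$, $t\in\mathbb{R}$, and let $\mathrm{p}(n,t)$ be the coefficient of $x^{n-1}$ in the monic orthogonal polynomial $P_n(x;t)$ of degree $n$ with respect to $w(x;t)=x^\lambda e^{-x^2+tx}$ on $(0,\infty)$, with $\mathrm{p}(0,t)=0$. For $n=0,1,2,\ldots$ define $$\sigma_n(s):=-2\mathrm{p}(n,t)-(n+\lambda)t,\qquad s=\tfrac12 t.$$ Then $\sigma_n(s)$ satisfies the Jimbo-Miwa-Okamoto $\sigma$-form of Painlevé IV (with $'=d/ds$) $$(\sigma_n''(s))^2=4\big(s\sigma_n'(s)-\sigma_n(s)\big)^2-4\big(\sigma_n'(s)+\nu_0\big)\big(\sigma_n'(s)+\nu_1\big)\big(\sigma_n'(s)+\nu_2\big),$$ with parameters $\nu_0=0$, $\nu_1=2\lambda$, $\nu_2=2n+2\lambda$. Moreover, for $n\ge1$, writing $\sigma_k=\sigma_k(s)$, the sequence also satisfies the discrete $\sigma$-form of Painlevé IV $$2\left[\sigma_n+n(\sigma_{n-1}-\sigma_{n+1})+2\lambda s\right]\left[\sigma_n+(n+\lambda)(\sigma_{n-1}-\sigma_{n+1})\right]$$ $$=\left[\sigma_n+2(n+\lambda)s\right](\sigma_{n+1}-\sigma_{n-1}+2s)(\sigma_{n-1}-\sigma_n)(\sigma_n-\sigma_{n+1}).$$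
   Context: For $\lambda>0$ and $t\in\mathbb{R}$, let $w(x;t)=x^\lambda e^{-x^2+tx}$ for $x\in(0,\infty)$. $P_n(x;t)=x^n+\mathrm{p}(n,t)x^{n-1}+\cdots+P_n(0;t)$ is the monic polynomial of degree $n$ in $x$ with $\int_0^\infty P_m(x;t)P_n(x;t)w(x;t)\,dx=h_n(t)\delta_{mn}$ for $m,n\ge 0$. *)

(* Defs.v *)
From HB Require Import structures.
From mathcomp Require Import all_boot all_order all_algebra.
From mathcomp Require Import all_classical all_reals all_analysis.

Set Implicit Arguments.
Unset Strict Implicit.
Unset Printing Implicit Defensive.

Import Order.TTheory GRing.Theory Num.Theory.
Import numFieldNormedType.Exports.

Local Open Scope classical_set_scope.
Local Open Scope ring_scope.

Definition weight (R : realType) (lambda t x : R) : R :=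
  x `^ lambda * expR (- x ^+ 2 + t * x).

(* Polynomials times the weight are absolutely integrable on (0, +oo) when
   lambda > -1, so the extended-real Lebesgue integral is here the usual
   (improper) one. *)
Definition monic_OPS (R : realType) (lambda : R)
    (P : nat -> R -> {poly R}) (h : nat -> R -> R) : Prop :=
  (forall (n : nat) (t : R), P n t \is monic /\ size (P n t) = n.+1) /\
  (forall (m n : nat) (t : R),
    (\int[lebesgue_measure]_(x in `]0%R, +oo[)
       ((P m t).[x] * (P n t).[x] * weight lambda t x)%R%:E)%E
     = (h n t * (m == n)%:R)%:E).

Definition subleading (R : realType) (P : nat -> R -> {poly R})
    (n : nat) (t : R) : R :=
  if n is m.+1 then (P n t)`_m else 0.

(* The variable is s = t / 2. *)
Definition sigma (R : realType) (lambda : R) (P : nat -> R -> {poly R})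
    (n : nat) (s : R) : R :=
  let t := 2 * s in - 2 * subleading P n t - (n%:R + lambda) * t.

(* derive1 is total, so the differentiability that the ODE presupposes is
   stated explicitly. *)
Definition sigma_PIV_at (R : realType) (nu0 nu1 nu2 : R) (f : R -> R)
    (s : R) : Prop :=
  let f1 := f^`()%classic in
  let f2 := f1^`()%classic in
  [/\ derivable f s 1, derivable f1 s 1 &
      (f2 s) ^+ 2 =
        4 * (s * f1 s - f s) ^+ 2
        - 4 * (f1 s + nu0) * (f1 s + nu1) * (f1 s + nu2)].

Definition discrete_sigma_PIV_at (R : realType) (lambda : R)
    (sg : nat -> R -> R) (n : nat) (s : R) : Prop :=
  2 * (sg n s + n%:R * (sg n.-1 s - sg n.+1 s) + 2 * lambda * s)
    * (sg n s + (n%:R + lambda) * (sg n.-1 s - sg n.+1 s))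
  = (sg n s + 2 * (n%:R + lambda) * s)
    * (sg n.+1 s - sg n.-1 s + 2 * s)
    * (sg n.-1 s - sg n s) * (sg n s - sg n.+1 s).

(* Main.v *)
From HB Require Import structures.
Require Import Defs.
From mathcomp Require Import all_boot all_order all_algebra.
From mathcomp Require Import all_classical all_reals all_analysis.
From mathcomp Require Import measurable_realfun ring.

(** Write L_t(q) for the integral of q(x) w(x;t) over the half-line, P_n for
    the orthogonal polynomials, p(n) for their subleading coefficients, and
    x P_n = P_{n+1} + alpha_n P_n + beta_n P_{n-1} for the three-term
    recurrence ([three_term]).  Here alpha_n = p(n) - p(n+1) and
    beta_n = h_n / h_{n-1}, so sigma_n and its shifts are affine in p and
    alpha, and everything reduces to relations among p, alpha and beta.

    The weight enters through two properties only.

    In x, (x w)' = (lambda + 1 + t x - 2 x^2) w, and x w vanishes at both ends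
    of the half-line; hence L_t(x q' + (lambda + 1 + t x - 2 x^2) q) = 0 for
    every polynomial q ([pearson_weight]).  Taking q = P_n^2 and
    q = P_n P_{n-1} gives the two string equations [string_diag] and
    [string_sub]; combining them, with
      r_n = 2 beta_n - n   and   R_n = 2 alpha_n - t,
    the quantity r_n^2 - lambda r_n - beta_n R_n R_{n-1} does not depend on n,
    and it vanishes at n = 0: this is [string_quad].

    In t, the derivative of w is x w.  So the k-th moment has derivative the
    (k+1)-st one ([is_derive_moment]), the recurrence propagates
    differentiability in t from the moments to all the coefficients of the P_n
    ([derivable_coef_P]), and differentiating the orthogonality relations
    yields the Toda equations p(n)' = - beta_n and
    beta_n' = beta_n (alpha_n - alpha_{n-1})
    ([is_derive_subleading_coef], [is_derive_beta]).

    With s = t/2 one gets sigma' = 2 (r_n - lambda),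
    sigma'' = 4 beta_n (R_n - R_{n-1}) and, by [string_sub],
    s sigma' - sigma = - 2 beta_n (R_n + R_{n-1}).  The sigma-form is then
    (R_n - R_{n-1})^2 = (R_n + R_{n-1})^2 - 4 R_n R_{n-1} multiplied by
    16 beta_n^2, with beta_n R_n R_{n-1} replaced by r_n^2 - lambda r_n.
    The discrete equation is the same quadratic relation, multiplied by
    2 (R_n + R_{n-1} + t)^2: the differences of consecutive sigma_k are the
    R_k, and the two factors of its left-hand side are
    r_n (R_n + R_{n-1} + t) and (r_n - lambda) (R_n + R_{n-1} + t). *)

Set Implicit Arguments.
Unset Strict Implicit.
Unset Printing Implicit Defensive.

Import Order.TTheory GRing.Theory Num.Theory.
Import numFieldNormedType.Exports.

Local Open Scope ring_scope.

(** * Moment functionals *)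

Section MomentFunctional.
Context {F : fieldType} (m : nat -> F).

(** Defining the functional on coefficients makes it linear for an arbitrary
    moment sequence and lets a dependence on t enter through finitely many
    scalars; [integral_horner_weight] identifies it with the integral. *)
Definition moment_fun (q : {poly F}) : F := \sum_(i < size q) q`_i * m i.

Lemma moment_funE N (q : {poly F}) : (size q <= N)%N ->
  moment_fun q = \sum_(i < N) q`_i * m i.
Proof.
move=> qN; rewrite /moment_fun (big_ord_widen N (fun i => q`_i * m i)) //.
rewrite big_mkcond; apply: eq_bigr => i _; case: ltnP => // ?.
by rewrite nth_default // mul0r.
Qed.

Fact moment_fun_linear : linear_for *%R moment_fun.
Proof.
move=> a p q; set N := maxn (size p) (size q).
rewrite !(@moment_funE N) ?leq_maxl ?leq_maxr //; last first.
  by rewrite (leq_trans (size_polyD _ _)) // geq_max leq_maxr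
    (leq_trans (size_scale_leq _ _)) ?leq_maxl.
rewrite mulr_sumr -big_split /=; apply: eq_bigr => i _.
by rewrite coefD coefZ mulrDl mulrA.
Qed.

HB.instance Definition _ := GRing.isLinear.Build F {poly F} F *%R
  moment_fun moment_fun_linear.

End MomentFunctional.

Definition subleading_coef {F : fieldType} (P : nat -> {poly F}) n :=
  if n is k.+1 then (P n)`_k else 0.

Arguments subleading_coef : simpl never.

(** * Recurrence and string equations of orthogonal polynomials *)

Section Orthogonal.
Context {F : fieldType} (m : nat -> F) (P : nat -> {poly F}) (h : nat -> F).
Local Notation L := (moment_fun m).
Hypothesis P_monic : forall n, P n \is monic.
Hypothesis size_P : forall n, size (P n) = n.+1.
Hypothesis L_PP : forall i j, L (P i * P j) = h i * (i == j)%:R.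
Hypothesis h_neq0 : forall n, h n != 0.

Definition rec_alpha n := subleading_coef P n - subleading_coef P n.+1.
(** With the value 0 at n = 0, the recurrence and the string equations hold
    from n = 0 on: whatever stands for the index -1 is multiplied by 0. *)
Definition rec_beta n := if n is k.+1 then h n / h k else 0.
Arguments rec_alpha : simpl never.
Arguments rec_beta : simpl never.
Local Notation alpha := rec_alpha.
Local Notation beta := rec_beta.
Definition pred_poly n := if n is k.+1 then P k else 0.

Lemma coef_Pn n : (P n)`_n = 1.
Proof. by move/monicP: (P_monic n); rewrite /lead_coef size_P. Qed.

Lemma coef_P_gt n i : (n < i)%N -> (P n)`_i = 0.
Proof. by move=> ni; rewrite nth_default // size_P. Qed.

Lemma size_sub_lead k (q : {poly F}) : (size q <= k.+1)%N ->
  (size (q - q`_k *: P k)%R <= k)%N.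
Proof.
move=> qk; apply/leq_sizeP => j; rewrite leq_eqVlt => /orP[/eqP<-|kj].
  by rewrite coefB coefZ coef_Pn mulr1 subrr.
by rewrite coefB coefZ coef_P_gt // mulr0 subr0 nth_default // (leq_trans qk).
Qed.

(** Subtracting from q the multiple of P_k that cancels its top coefficient
    lowers the degree, so q is a combination of the P_k of index at most its
    degree. *)
Lemma ortho_lower n (q : {poly F}) : (size q <= n)%N -> L (P n * q) = 0.
Proof.
have [k qk] := ubnPleq (size q).
elim: k q qk => [|k IH] q qk qn.
  by move: qk; rewrite leqn0 size_poly_eq0 => /eqP->; rewrite mulr0 raddf0.
rewrite -(subrK (q`_k *: P k) q) mulrDr raddfD /= -scalerAr scalarZ /=.
rewrite L_PP gtn_eqF // !mulr0 addr0.
by rewrite IH ?size_sub_lead // ltnW.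
Qed.

Lemma ortho_lead n (q : {poly F}) : (size q <= n.+1)%N ->
  L (P n * q) = q`_n * h n.
Proof.
move=> qn; rewrite -[in LHS](subrK (q`_n *: P n) q) mulrDr raddfD /=.
rewrite ortho_lower ?size_sub_lead // add0r -scalerAr scalarZ /= L_PP eqxx.
by rewrite mulr1.
Qed.

(** This is how polynomial identities are proved below: the pairing of r with
    P_k, for k the degree of r, is the leading coefficient of r times h_k. *)
Lemma ortho_eq0 n (r : {poly F}) : (size r <= n)%N ->
  (forall k, (k < n)%N -> L (P k * r) = 0) -> r = 0.
Proof.
move=> rn Lr; apply: contraTeq isT => r0.
have sr : size r = (size r).-1.+1 by rewrite prednK // size_poly_gt0.
have := Lr (size r).-1; rewrite -sr => /(_ rn).
rewrite ortho_lead -?sr // => /eqP; rewrite mulf_eq0 (negPf (h_neq0 _)) orbF.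
by rewrite -lead_coefE lead_coef_eq0 (negPf r0).
Qed.

Lemma size_XP n : size ('X * P n) = n.+2.
Proof. by rewrite mulrC size_mulX ?size_P // -size_poly_gt0 size_P. Qed.

Lemma subleading_coefE n : subleading_coef P n = ('X * P n)`_n.
Proof. by rewrite coefXM; case: n. Qed.

(** The choice of alpha makes the difference of the two sides have degree less
    than n.  Pairing it with P_k only involves the degree of x P_k, which is
    below n unless k = n - 1; in that case h_n = beta_n h_{n-1} is needed. *)
Lemma three_term n :
  'X * P n = P n.+1 + alpha n *: P n + beta n *: pred_poly n.
Proof.
apply/eqP; rewrite -subr_eq0; apply/eqP/(@ortho_eq0 n).
  apply/leq_sizeP => j nj; rewrite coefB !coefD !coefZ.
  have -> : (pred_poly n)`_j = 0.
    by case: n nj => [|n] nj; rewrite ?coef0 // coef_P_gt.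
  move: nj; rewrite leq_eqVlt => /orP[/eqP<-|].
    rewrite -subleading_coefE coef_Pn mulr0 mulr1 addr0.
    rewrite -[(P n.+1)`_n]/(subleading_coef P n.+1).
    by rewrite /rec_alpha [_ + (_ - _)]addrC subrK subrr.
  rewrite leq_eqVlt => /orP[/eqP<-|nj].
    by rewrite coefXM /= !coef_Pn coef_P_gt // !mulr0 !addr0 subrr.
  rewrite coef_P_gt // coef_P_gt; last by apply: ltnW.
  by rewrite nth_default ?size_XP // !mulr0 !addr0 subr0.
move=> k kn; rewrite mulrBr !mulrDr -!scalerAr raddfB /= !raddfD /=.
rewrite ?scalarZ /= !L_PP.
rewrite !ltn_eqF //; last by apply: ltnW.
rewrite !mulr0 !oppr0 !add0r mulrCA mulrA [_ * P n]mulrC.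
rewrite ortho_lead ?size_XP; last by apply: leq_trans kn _.
case: n kn => [|n] //=; rewrite ltnS leq_eqVlt => /orP[/eqP->|kn].
  by rewrite L_PP eqxx coefXM coef_Pn mulr1 mul1r /rec_beta divfK // subrr.
by rewrite L_PP ltn_eqF // coefXM coef_P_gt // !(mul0r, mulr0) subrr.
Qed.

Lemma ortho_XPP n : L (P n * ('X * P n)) = alpha n * h n.
Proof.
rewrite three_term !mulrDr -!scalerAr !raddfD /= ?scalarZ /= !L_PP eqxx ltn_eqF //.
rewrite ortho_lower ?mulr0 ?mulr1 ?add0r ?addr0 //.
by case: n => [|n]; rewrite ?size_poly0 ?size_P.
Qed.

Lemma ortho_XPP_succ n : L (P n.+1 * ('X * P n)) = h n.+1.
Proof. by rewrite ortho_lead ?size_XP // coefXM coef_Pn mul1r. Qed.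

Lemma ortho_Xpred n : beta n * L (pred_poly n * ('X * P n)) = beta n * h n.
Proof.
case: n => [|n]; first by rewrite /rec_beta !mul0r.
by rewrite /= -ortho_XPP_succ; congr (_ * L _); ring.
Qed.

Variables lambda t : F.
(** Integration by parts for a weight w with
    (x w)' = (lambda + 1 + t x - 2 x^2) w: the argument of the functional,
    multiplied by w, is the derivative of x q w. *)
Hypothesis pearson : forall q : {poly F},
  L ('X * q^`() + ((lambda + 1) *: q + t *: ('X * q) - 2 *: ('X * ('X * q)))) = 0.

Lemma coef_Xderiv n : ('X * (P n)^`())`_n = n%:R.
Proof. by rewrite coefXM; case: n => //= n; rewrite coef_deriv coef_Pn. Qed.

Lemma size_Xderiv n : (size ('X * (P n)^`())%R <= n.+1)%N.
Proof.
apply/leq_sizeP => j nj; rewrite coefXM; case: j nj => //= j nj.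
by rewrite coef_deriv coef_P_gt // mul0rn.
Qed.

Lemma beta_h n : beta n.+1 * h n = h n.+1.
Proof. by rewrite /rec_beta divfK. Qed.

(** The integration by parts for q = P_n^2, with x P_n expanded by the
    recurrence. *)
Lemma string_diag n :
  2 * n%:R + 1 + lambda
  = 2 * (alpha n ^+ 2 + beta n + beta n.+1) - t * alpha n.
Proof.
have := pearson (P n * P n).
have -> : 'X * (P n * P n)^`() = 2 *: (P n * ('X * (P n)^`())).
  by rewrite derivM scaler_nat; ring.
rewrite !(mulrCA 'X (P n)) !raddfD /= [L (- _)]raddfN /= !scalarZ /=.
rewrite ortho_lead ?size_Xderiv // coef_Xderiv L_PP eqxx mulr1 ortho_XPP.
have -> : L (P n * ('X * ('X * P n)))
        = (beta n.+1 + alpha n ^+ 2 + beta n) * h n.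
  rewrite mulrCA mulrA {1}three_term !mulrDl -!scalerAl !raddfD /= ?scalarZ /=.
  by rewrite ortho_XPP_succ ortho_XPP ortho_Xpred -beta_h expr2 mulrA.
move=> E; apply: (mulIf (h_neq0 n)); apply/eqP; rewrite -subr_eq0 -E.
by apply/eqP; ring.
Qed.

(** The integration by parts for q = P_n P_{n-1}.  The subleading coefficient
    appears because x P_n' - n P_n has degree n - 1 and leading coefficient
    - p(n). *)
Lemma string_sub n :
  subleading_coef P n + beta n * (2 * alpha n + 2 * alpha n.-1 - t) = 0.
Proof.
case: n => [|n]; first by rewrite /= mul0r addr0.
rewrite [n.+1.-1]/=.
have := pearson (P n.+1 * P n).
rewrite derivM !raddfD /= [L (- _)]raddfN /= !scalarZ /=.
rewrite L_PP gtn_eqF // !mulr0 add0r mulrDr raddfD /=.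
have -> : L ('X * (P n.+1 * (P n)^`())) = 0.
  by rewrite mulrCA ortho_lower // size_Xderiv.
have -> : L ('X * ((P n.+1)^`() * P n)) = - subleading_coef P n.+1 * h n.
  (* removing (n+1) P_{n+1} brings the degree down to n *)
  set q := 'X * (P n.+1)^`() - n.+1%:R *: P n.+1.
  have -> : 'X * ((P n.+1)^`() * P n) = P n * q + n.+1%:R *: (P n.+1 * P n).
    rewrite /q mulrBr -!scalerAr [P n.+1 * P n]mulrC subrK.
    by ring.
  rewrite raddfD /= scalarZ /= L_PP gtn_eqF // !mulr0 addr0 ortho_lead.
    congr (_ * _); rewrite /subleading_coef coefB coefZ coefXM.
    case: n @q => [|n] q /=; rewrite ?coef_deriv /=; first by rewrite mul1r sub0r.
    by rewrite -mulr_natl; ring.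
  apply/leq_sizeP => j; rewrite leq_eqVlt => /orP[/eqP<-|nj].
    by rewrite coefB coefZ coef_Xderiv coef_Pn mulr1 subrr.
  rewrite coefB coefZ coef_P_gt // mulr0 subr0 nth_default //.
  exact: leq_trans (size_Xderiv _) _.
have -> : L ('X * (P n.+1 * P n)) = h n.+1 by rewrite mulrCA ortho_XPP_succ.
have -> : L ('X * ('X * (P n.+1 * P n))) = h n.+1 * (alpha n + alpha n.+1).
  have -> : 'X * ('X * (P n.+1 * P n)) = ('X * P n) * ('X * P n.+1) by ring.
  rewrite {1}three_term !mulrDl -!scalerAl !raddfD /= !scalarZ /= ortho_XPP.
  have -> : P n * ('X * P n.+1) = P n.+1 * ('X * P n) by ring.
  rewrite ortho_XPP_succ.
  have -> : L (pred_poly n * ('X * P n.+1)) = 0.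
    case: n => [|n]; first by rewrite mul0r raddf0.
    by rewrite mulrCA [_ * P n.+2]mulrC mulrCA ortho_lower // size_XP.
  by rewrite mulr0 addr0; ring.
rewrite -beta_h => E; apply: (mulIf (h_neq0 n)).
by rewrite mul0r -[RHS]oppr0 -E; ring.
Qed.

Let r n := 2 * beta n - n%:R.
Let R n := 2 * alpha n - t.

(** Discrete integration.  Multiplying [string_diag] by r_{n+1} - r_n produces
    on the left the increment of r_n^2 - lambda r_n and on the right
    - alpha_n R_n (r_{n+1} - r_n); by the difference of two consecutive
    instances of [string_sub] the latter is the increment of
    beta_n R_n R_{n-1}.  Both quantities vanish at n = 0. *)
Lemma string_quad n : r n ^+ 2 - lambda * r n = beta n * R n * R n.-1.
Proof.
elim: n => [|n IH]; first by rewrite /r /= mulr0 subr0 expr2 !mul0r mulr0 subrr.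
have S1 := string_sub n.+1; have S0 := string_sub n; have S2 := string_diag n.
have Ea : alpha n = subleading_coef P n - subleading_coef P n.+1 by [].
move: IH S1 S0 S2 Ea; rewrite /r /R [n.+1.-1]/= -(natr1 n).
set a := alpha n; set b := alpha n.+1; set c := alpha n.-1.
set be := beta n; set be1 := beta n.+1.
set p := subleading_coef P n; set p1 := subleading_coef P n.+1.
move: a b c be be1 p p1 n%:R => a b c be be1 p p1 N IH S1 S0 S2 Ea.
apply/eqP; rewrite -subr_eq0; apply/eqP.
(* previous instance + string_diag * (r_{n+1} - r_n)
   - R_n * (difference of two instances of string_sub) *)
transitivity ((((2 * be - N) ^+ 2 - lambda * (2 * be - N))
   - (be * (2 * a - t) * (2 * c - t)))
  + (2 * (a ^+ 2 + be + be1) - t * a - (2 * N + 1 + lambda))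
    * (2 * be1 - 2 * be - 1)
  - (2 * a - t) * ((p1 + be1 * (2 * b + 2 * a - t))
    - (p + be * (2 * a + 2 * c - t)) - (a - (p - p1)))).
  by ring.
by rewrite IH S1 S0 S2 Ea !subrr !(mul0r, mulr0, addr0, subr0).
Qed.

End Orthogonal.

(** * Differentiable families of polynomials and the Toda equations *)

Section PolynomialFamilies.
Context {R : realType}.
Implicit Types (q r : R -> {poly R}) (dq dr : {poly R}) (t : R).

Definition is_pderive t q dq :=
  forall i, is_derive t 1 (fun u => (q u)`_i) dq`_i.

Lemma is_pderiveM t q r dq dr : is_pderive t q dq -> is_pderive t r dr ->
  is_pderive t (fun u => q u * r u) (dq * r t + q t * dr).
Proof.
move=> Dq Dr i.
have -> : (fun u => (q u * r u)`_i)
        = \sum_(j < i.+1) (fun u => (q u)`_j * (r u)`_(i - j)).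
  by apply/funext => u; rewrite coefM fct_sumE.
apply: is_derive_eq; first by apply: is_derive_sum => j; apply: is_deriveM.
rewrite coefD !coefM -big_split /=; apply: eq_bigr => j _.
by rewrite addrC /GRing.scale /= [_ * dq`_j]mulrC.
Qed.

Lemma is_pderiveX t q dq : is_pderive t q dq ->
  is_pderive t (fun u => 'X * q u) ('X * dq).
Proof.
move=> Dq [|i].
  rewrite coefXM; under eq_fun do rewrite coefXM /=; exact: is_derive_cst.
by rewrite coefXM; under eq_fun do rewrite coefXM /=; exact: Dq.
Qed.

(** Leibniz rule: the variation of the polynomial and that of the weight
    contribute separately, the latter as a multiplication by x.  The uniform
    bound N on the size keeps the range of summation independent of t. *)
Lemma is_derive_moment_fun (mu : R -> nat -> R) t q dq N :
  (forall k, is_derive t 1 (fun u => mu u k) (mu t k.+1)) ->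
  (forall u, (size (q u) <= N)%N) -> is_pderive t q dq ->
  is_derive t 1 (fun u => moment_fun (mu u) (q u))
    (moment_fun (mu t) dq + moment_fun (mu t) ('X * q t)).
Proof.
move=> Dmu qN Dq; pose M := maxn N (size dq).
have -> : (fun u => moment_fun (mu u) (q u))
        = \sum_(j < M) (fun u => (q u)`_j * mu u j).
  apply/funext => u; rewrite fct_sumE (@moment_funE _ _ M) //.
  by rewrite (leq_trans (qN u)) // leq_maxl.
apply: is_derive_eq.
  by apply: is_derive_sum => j; apply: is_deriveM.
rewrite (@moment_funE _ _ M _ (leq_maxr _ _)) (@moment_funE _ _ M.+1); last first.
  by rewrite (leq_trans (size_polyMleq _ _)) // size_polyX /= ltnS
    (leq_trans (qN t)) // leq_maxl.
rewrite big_ord_recl coefXM mul0r add0r -big_split /=; apply: eq_bigr => j _.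
by rewrite coefXM /= addrC /GRing.scale /= [_ * dq`_j]mulrC.
Qed.

End PolynomialFamilies.

Section Toda.
Context {R : realType} (mu : R -> nat -> R).
Context (P : nat -> R -> {poly R}) (h : nat -> R -> R).
Local Notation L t := (moment_fun (mu t)).
Hypothesis Dmu : forall (t : R) k, is_derive t 1 (fun u => mu u k) (mu t k.+1).
Hypothesis P_monic : forall n t, P n t \is monic.
Hypothesis size_P : forall n t, size (P n t) = n.+1.
Hypothesis L_PP : forall i j t, L t (P i t * P j t) = h i t * (i == j)%:R.
Hypothesis h_neq0 : forall n t, h n t != 0.

Local Notation alpha n t := (rec_alpha (P ^~ t) n).
Local Notation beta n t := (rec_beta (h ^~ t) n).

Let Pt_monic t n := P_monic n t.
Let size_Pt t n := size_P n t.
Let Lt_PP t i j := L_PP i j t.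
Let ht_neq0 t n := h_neq0 n t.

(** The leading coefficient is constant, so the derivative has lower degree and
    is therefore orthogonal to P_n. *)
Lemma pderive_monic n t :
  (forall i, derivable (fun u => (P n u)`_i) t 1) ->
  exists2 dP : {poly R}, (size dP <= n)%N & is_pderive t (P n) dP.
Proof.
move=> DP; exists (\poly_(i < n) ('D_1 (fun u => (P n u)`_i) t)).
  exact: size_poly.
move=> i; rewrite coef_poly; case: ltnP => [ni|].
  exact: DeriveDef.
rewrite leq_eqVlt => /orP[/eqP ni|ni].
  have -> : (fun u => (P n u)`_i) = cst 1.
    apply/funext => u; rewrite -ni.
    exact: (coef_Pn (Pt_monic u) (size_Pt u)).
  exact: is_derive_cst.
have -> : (fun u => (P n u)`_i) = cst 0.
  by apply/funext => u; rewrite nth_default // size_P.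
exact: is_derive_cst.
Qed.

Let size_PP i j u : (size (P i u * P j u)%R <= (i + j).+1)%N.
Proof. by rewrite (leq_trans (size_polyMleq _ _)) // !size_P addnS. Qed.

Lemma is_derive_norm_of n t (dP : {poly R}) :
  (size dP <= n)%N -> is_pderive t (P n) dP ->
  is_derive t 1 (h n) (alpha n t * h n t).
Proof.
move=> sdP DP.
have -> : h n = (fun u => L u (P n u * P n u)).
  by apply/funext => u; rewrite L_PP eqxx mulr1.
apply: is_derive_eq.
  apply: (is_derive_moment_fun (Dmu t) (size_PP n n)).
  exact: (is_pderiveM DP DP).
rewrite raddfD /= [dP * _]mulrC.
rewrite (ortho_lower (Pt_monic t) (size_Pt t) (@Lt_PP t) sdP) !add0r mulrCA.
rewrite [in RHS]L_PP eqxx mulr1.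
exact: (ortho_XPP (Pt_monic t) (size_Pt t) (@Lt_PP t) (ht_neq0 t)).
Qed.

(** By strong induction: h_n = L_t(P_n^2) and alpha_n = L_t(x P_n^2) / h_n are
    differentiable as soon as the coefficients of P_n are, and the recurrence
    passes this on to P_{n+1}. *)
Lemma derivable_coef_P n (t : R) i : derivable (fun u => (P n u)`_i) t 1.
Proof.
have [N] := ubnP n; elim: N => // N IH in n t i *.
rewrite ltnS => nN.
case: n nN => [_|n nN].
  have -> : (fun u => (P 0 u)`_i) = cst (i == 0)%:R.
    apply/funext => u; have /eqP := size_P 0 u; case/size_poly1P => c c0 E.
    have := monicP (P_monic 0 u); rewrite E lead_coefC => ->.
    by rewrite coefC; case: ifP.
  exact: derivable_cst.
have Dn : forall t i, derivable (fun u => (P n u)`_i) t 1.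
  by move=> ? ?; apply: IH.
have Dh k : (k <= n)%N -> derivable (h k) t 1.
  move=> kn; have [|dP sdP DP] := @pderive_monic k t.
    by move=> j; apply: IH; apply: leq_trans nN.
  exact: (@ex_derive _ _ _ _ _ _ _ (is_derive_norm_of sdP DP)).
have alphaE u : alpha n u = L u (P n u * ('X * P n u)) / h n u.
  by rewrite (ortho_XPP (Pt_monic u) (size_Pt u) (@Lt_PP u) (ht_neq0 u)) mulfK.
have Da : derivable (fun u => alpha n u) t 1.
  under eq_fun do rewrite alphaE.
  apply: derivableM; last by apply: derivableV => //; exact: Dh.
  have [//|dP sdP DP] := @pderive_monic n t.
  have := is_derive_moment_fun (Dmu t) _ (is_pderiveM DP (is_pderiveX DP)).
  move=> /(_ (n + n.+1).+1) H; apply: (@ex_derive _ _ _ _ _ _ _ (H _)) => u.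
  rewrite (leq_trans (size_polyMleq _ _)) // size_P mulrC size_mulX ?size_P //.
    by rewrite addnS.
  by rewrite -size_poly_gt0 size_P.
have Db : derivable (fun u => beta n u * (pred_poly (P ^~ u) n)`_i) t 1.
  case: n nN {Dn Da alphaE} Dh IH => [|n] nN Dh IH.
    have -> : (fun u => beta 0 u * (pred_poly (P ^~ u) 0)`_i) = cst 0.
      by apply/funext => u; rewrite /rec_beta mul0r.
    exact: derivable_cst.
  apply: derivableM; last by apply: IH; apply: ltnW.
  apply: derivableM; first exact: Dh.
  by apply: derivableV => //; exact: Dh.
have -> : (fun u => (P n.+1 u)`_i)
  = (fun u => ('X * P n u)`_i - alpha n u * (P n u)`_i
              - beta n u * (pred_poly (P ^~ u) n)`_i).
  apply/funext => u.
  rewrite (three_term (Pt_monic u) (size_Pt u) (@Lt_PP u) (ht_neq0 u)).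
by rewrite !coefD !coefZ [_ + _ - _]addrAC addrK addrK.
apply: derivableB => //; apply: derivableB; last by apply: derivableM.
have -> : (fun u => ('X * P n u)`_i)
        = if i is j.+1 then fun u => (P n u)`_j else cst 0.
  by apply/funext => u; rewrite coefXM; case: i {Db}.
by case: i {Db} => [|i]; [exact: derivable_cst|exact: Dn].
Qed.

Lemma pderive_P n t :
  exists2 dP : {poly R}, (size dP <= n)%N & is_pderive t (P n) dP.
Proof. by apply: pderive_monic => i; exact: derivable_coef_P. Qed.

Lemma is_derive_norm n (t : R) : is_derive t 1 (h n) (alpha n t * h n t).
Proof. by have [dP sdP DP] := pderive_P n t; apply: is_derive_norm_of DP. Qed.

(** Differentiate L_t(P_{n+1} P_n) = 0.  The three terms are the leading
    coefficient of the derivative of P_{n+1}, which is that of p(n+1), times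
    h_n; then 0; then L_t(x P_{n+1} P_n) = h_{n+1}. *)
Lemma is_derive_subleading_coef n (t : R) :
  is_derive t 1 (fun u => subleading_coef (P ^~ u) n) (- beta n t).
Proof.
case: n => [|n].
  by rewrite /rec_beta oppr0 /subleading_coef; exact: is_derive_cst.
have [dP sdP DP] := pderive_P n.+1 t; have [dQ sdQ DQ] := pderive_P n t.
rewrite /subleading_coef; suff -> : - beta n.+1 t = dP`_n by exact: DP.
have D0 := is_derive_moment_fun (Dmu t) (size_PP n.+1 n) (is_pderiveM DP DQ).
have D1 : is_derive t 1 (fun u => L u (P n.+1 u * P n u)) 0.
  have -> : (fun u => L u (P n.+1 u * P n u)) = cst 0.
    by apply/funext => u; rewrite L_PP gtn_eqF // mulr0.
  exact: is_derive_cst.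
have := @derive_val _ _ _ _ _ _ _ D0; rewrite (@derive_val _ _ _ _ _ _ _ D1).
rewrite raddfD /= [dP * _]mulrC mulrCA.
rewrite (ortho_lead (Pt_monic t) (size_Pt t) (@Lt_PP t) sdP).
rewrite (ortho_lower (Pt_monic t) (size_Pt t) (@Lt_PP t)); last exact: leqW.
rewrite (ortho_XPP_succ (Pt_monic t) (size_Pt t) (@Lt_PP t)) addr0.
rewrite -(beta_h (ht_neq0 t)) -mulrDl => /esym/eqP.
rewrite mulf_eq0 (negPf (h_neq0 _ _)) orbF addr_eq0 => /eqP->.
by rewrite mulfK.
Qed.

Lemma is_derive_beta n (t : R) :
  is_derive t 1 (fun u => beta n u) (beta n t * (alpha n t - alpha n.-1 t)).
Proof.
case: n => [|n].
  by rewrite /rec_beta mul0r; exact: is_derive_cst.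
rewrite /rec_beta /=.
have Dn := is_derive_norm n t; have Dn1 := is_derive_norm n.+1 t.
have D1 : is_derive t 1 (fun u => (h n u)^-1) (- (h n t) ^- 2 *: (alpha n t * h n t)).
  exact: is_deriveV.
apply: (is_derive_eq (is_deriveM Dn1 D1)).
rewrite /GRing.scale /=; field; exact: h_neq0.
Qed.

End Toda.

(** * Integration on the half-line *)

Section HalfLine.
Local Open Scope classical_set_scope.
Local Open Scope ring_scope.
Context {R : realType}.
Local Notation leb := (@lebesgue_measure R).
Local Notation D := (`]0%R, +oo[%classic : set R).
Implicit Types (f F : R -> R) (C : R).

Lemma cvg_expRN_y C : C * expR (- x) @[x --> +oo] --> (0 : R).
Proof.
rewrite -(mulr0 C); apply: cvgM; [exact: cvg_cst|exact: cvgr_expR].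
Qed.

Lemma is_derive_expRN C (x : R) :
  is_derive x 1 (fun y => C * expR (- y)) (- (C * expR (- x))).
Proof.
apply: is_derive_eq; rewrite /GRing.scale /=.
by rewrite mulrN1 mulrN.
Qed.

Lemma continuous_expRN C : continuous (fun y : R => C * expR (- y)).
Proof.
by move=> x; apply/differentiable_continuous/derivable1_diffP;
  exact: (@ex_derive _ _ _ _ _ _ _ (is_derive_expRN C x)).
Qed.

Lemma measurable_expRN C : measurable_fun D (fun y => C * expR (- y)).
Proof.
apply: (@measurable_funTS _ _ _ _ D); apply: continuous_measurable_fun.
exact: continuous_expRN.
Qed.

Lemma integral_open_closed (f : R -> R) : measurable_fun D f ->
  (\int[leb]_(x in D) (f x)%:E = \int[leb]_(x in `[0%R, +oo[) (f x)%:E)%E.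
Proof. by move=> mf; apply: integral_itv_obnd_cbnd; exact/measurable_EFinP. Qed.

Lemma integral_expRN C : 0 <= C ->
  (\int[leb]_(x in D) (C * expR (- x))%:E = C%:E)%E.
Proof.
move=> C0; have cE := @continuous_expRN C.
rewrite integral_open_closed; last exact: measurable_expRN.
rewrite (@ge0_continuous_FTC2y _ _ (fun x => - (C * expR (- x))) 0 0).
- by rewrite oppr0 expR0 mulr1 sub0e EFinN oppeK.
- by move=> x _; rewrite mulr_ge0 // expR_ge0.
- exact: continuous_subspaceT.
- by rewrite -oppr0; apply: cvgN; exact: cvg_expRN_y.
- by move=> x _; exact: ex_derive.
- by apply: cvgN; apply/cvg_at_right_filter; exact: cE.
- move=> x _; rewrite derive1E; apply: derive_val.
  by rewrite -[C * expR (- x)]opprK; apply: is_deriveN; exact: is_derive_expRN.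
Qed.

Lemma integrable_le_expRN f C : measurable_fun D f ->
  (forall x, 0 < x -> `|f x| <= C * expR (- x)) -> leb.-integrable D (EFin \o f).
Proof.
move=> mf fC.
have C0 : 0 <= C.
  by rewrite -(pmulr_lge0 _ (expR_gt0 (-1))) (le_trans _ (fC 1 _)).
apply: (@le_integrable _ _ _ leb _ _ _ (EFin \o (fun x => C * expR (- x)))) => //.
- exact/measurable_EFinP.
- move=> x /=; rewrite in_itv/= andbT => x0.
  by rewrite lee_fin (le_trans (fC _ x0)) // ler_norm.
apply/integrableP; split.
  by apply/measurable_EFinP; exact: measurable_expRN.
under eq_integral do rewrite /= ger0_norm ?mulr_ge0 ?expR_ge0 //.
by rewrite integral_expRN // ltry.
Qed.

(** The fundamental theorem on an unbounded interval is applied to a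
    nonnegative integrand: adding to F the function - C exp(-x), which
    increases from - C to 0, turns the derivative f into the nonnegative
    f + C exp(-x), and the extra term has integral C. *)
Lemma integral_derive_eq0 F f C :
  (forall x, 0 <= x -> `|f x| <= C * expR (- x)) ->
  (forall x, 0 <= x -> `|F x| <= C * expR (- x)) ->
  (forall x : R, 0 < x -> is_derive x 1 F (f x)) ->
  {in `]0, +oo[, continuous f} -> f x @[x --> 0^'+] --> f 0 ->
  F x @[x --> 0^'+] --> F 0 -> F 0 = 0 ->
  (\int[leb]_(x in D) (f x)%:E = 0)%E.
Proof.
move=> fC FC dF cf f0 F0 F00.
have C0 : 0 <= C.
  by rewrite -(pmulr_lge0 _ (expR_gt0 (-1))) (le_trans _ (fC 1 _)).
have mf : measurable_fun D f.
  by apply: open_continuous_measurable_fun => //; exact/in_continuous_mksetP.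
have mE : measurable_fun D (fun x => C * expR (- x)).
  exact: measurable_expRN.
have fi : leb.-integrable D (EFin \o f).
  by apply: (integrable_le_expRN mf) => x /ltW; exact: fC.
have Ei : leb.-integrable D (EFin \o (fun x => C * expR (- x))).
  apply: (@integrable_le_expRN _ C mE) => x _.
  by rewrite ger0_norm // mulr_ge0 // expR_ge0.
suff : (\int[leb]_(x in D) (f x + C * expR (- x))%:E = C%:E)%E.
  under eq_integral do rewrite EFinD.
  rewrite integralD // integral_expRN // => E.
  have : (\int[leb]_(x in D) (f x)%:E)%E \is a fin_num.
    by apply: integrable_fin_num => //; exact: fi.
  move: E => /=; case: integral => //= r [E] _.
  by congr EFin; apply: (addIr C); rewrite E add0r.
rewrite integral_open_closed; last exact: measurable_funD.
rewrite (@ge0_continuous_FTC2y _ _ (fun x => F x - C * expR (- x)) 0 0).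
- by rewrite F00 oppr0 expR0 mulr1 sub0r sub0e EFinN oppeK.
- move=> x x0; rewrite -lerBlDr sub0r; have := fC _ x0.
  by rewrite ler_norml => /andP[].
- apply/continuous_within_itvcyP; split.
    by move=> x x0; apply: cvgD; [exact: cf|exact: continuous_expRN].
  by apply: cvgD => //; apply/cvg_at_right_filter; exact: continuous_expRN.
- rewrite -[X in _ --> X]subr0; apply: cvgB; last exact: cvg_expRN_y.
  apply: norm_cvg0; apply: (@squeeze_cvgr _ _ _ _ (cst 0) (fun x => C * expR (- x))).
  + near=> x; rewrite normr_ge0 FC //.
  + exact: cvg_cst.
  + exact: cvg_expRN_y.
- move=> x x0; apply: derivableB; first exact: (@ex_derive _ _ _ _ _ _ _ (dF _ x0)).
  exact: (@ex_derive _ _ _ _ _ _ _ (is_derive_expRN C x)).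
- by apply: cvgB => //; apply/cvg_at_right_filter; exact: continuous_expRN.
- move=> x; rewrite in_itv/= andbT => x0; rewrite derive1E; apply: derive_val.
  rewrite -[C * expR (- x)]opprK; apply: is_deriveB; first exact: dF.
  exact: is_derive_expRN.
Unshelve. all: by end_near. Qed.

End HalfLine.

(** * The moments of the weight *)

Section Weight.
Local Open Scope classical_set_scope.
Local Open Scope ring_scope.
Context {R : realType} (lambda : R).
Hypothesis lambda_gt0 : 0 < lambda.
Local Notation leb := (@lebesgue_measure R).
Local Notation D := (`]0%R, +oo[%classic : set R).
Local Notation w := (weight lambda).
Implicit Types (q : {poly R}) (t x : R).

Lemma weight_ge0 t x : 0 <= w t x.
Proof. by rewrite mulr_ge0 ?powR_ge0 ?expR_ge0. Qed.

Lemma weight_gt0 t x : 0 < x -> 0 < w t x.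
Proof. by move=> x0; rewrite mulr_gt0 ?powR_gt0 ?expR_gt0. Qed.

Lemma measurable_weight t : measurable_fun D (w t).
Proof.
apply: (@measurable_funTS _ _ _ _ D); apply: measurable_funM => //.
apply: measurableT_comp => //; apply: continuous_measurable_fun => x.
by apply: cvgD; [apply: cvgN; exact: exprn_continuous|exact: mulrl_continuous].
Qed.

Lemma weight_le t x : 0 <= x -> w t x <= expR ((lambda + t) * x - x ^+ 2).
Proof.
move=> x0.
have -> : (lambda + t) * x - x ^+ 2 = lambda * x + (- x ^+ 2 + t * x) by ring.
rewrite expRD ler_wpM2r ?expR_ge0 //.
rewrite le_eqVlt in x0; case/predU1P: x0 => [<-|x0].
  by rewrite powR0 ?gt_eqF // expR_ge0.
by rewrite /powR gt_eqF // ler_expR ler_pM2l // ltW // ln_sublinear.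
Qed.

(** An exponential bound, rather than a power one, absorbs the factor
    x^lambda as well: x^lambda <= exp(lambda x). *)
Lemma horner_le_expR q : exists C N : R, forall x, 0 <= x ->
  `|q.[x]| <= C * expR (N * x).
Proof.
suff [C [N [C0 N0 H]]] : exists C N : R, [/\ 0 <= C, 0 <= N &
    forall x, 0 <= x -> `|q.[x]| <= C * expR (N * x)] by exists C, N.
elim/poly_ind: q => [|q c [C [N [C0 N0 IH]]]].
  by exists 0, 0; split=> // x _; rewrite horner0 normr0 mul0r.
exists (C + `|c|), (N + 1); split; rewrite ?addr_ge0 // => x x0.
rewrite !hornerE (le_trans (ler_normD _ _)) // mulrDl lerD //.
  rewrite normrM (ger0_norm x0) mulrDl expRD mulrA mul1r ler_pM ?IH //.
  by rewrite (le_trans _ (expR_ge1Dx x)) // lerDr.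
rewrite ler_peMr // (le_trans _ (expR_ge1Dx _)) // lerDl.
by rewrite mulr_ge0 // addr_ge0.
Qed.

Lemma horner_weight_le q t : exists C, forall x, 0 <= x ->
  `|q.[x] * w t x| <= C * expR (- x).
Proof.
have [C [N H]] := horner_le_expR q; set a := N + lambda + t + 1.
have C0 : 0 <= C.
  by have := le_trans (normr_ge0 _) (H 0 (lexx 0)); rewrite mulr0 expR0 mulr1.
exists (C * expR (a ^+ 2 / 4)) => x x0.
rewrite normrM (ger0_norm (weight_ge0 _ _)).
apply: (@le_trans _ _ (C * expR (N * x) * expR ((lambda + t) * x - x ^+ 2))).
  by rewrite ler_pM ?weight_ge0 ?H ?weight_le.
rewrite -mulrA -[leRHS]mulrA -!expRD ler_wpM2l // ler_expR -subr_ge0.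
(* completing the square in a x - x^2 *)
have -> : a ^+ 2 / 4 - x - (N * x + ((lambda + t) * x - x ^+ 2))
  = (a / 2 - x) ^+ 2 by rewrite /a; field.
exact: sqr_ge0.
Qed.

Lemma measurable_horner_weight q t : measurable_fun D (fun x => q.[x] * w t x).
Proof.
apply: measurable_funM; last exact: measurable_weight.
apply: (@measurable_funTS _ _ _ _ D); apply: continuous_measurable_fun.
exact: continuous_horner.
Qed.

Lemma integrable_horner_weight q t :
  leb.-integrable D (EFin \o (fun x => q.[x] * w t x)).
Proof.
have [C H] := horner_weight_le q t.
by apply: (integrable_le_expRN (measurable_horner_weight q t)) => x /ltW; exact: H.
Qed.

Lemma finite_roots q : q != 0 -> finite_set [set x | root q x].
Proof.
have [n] := ubnP (size q); elim: n q => // n IH q; rewrite ltnS => qn q0.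
have [[a ra]|nr] := pselect (exists a, root q a); last first.
  rewrite (_ : [set x | root q x] = set0) // -subset0 => x rx.
  by apply: nr; exists x.
have /factor_theorem[p E] := ra.
have p0 : p != 0 by apply: contraNneq q0 => p0; rewrite E p0 mul0r.
apply: (@sub_finite_set _ _ ([set x | root p x] `|` [set a])).
  by move=> x /=; rewrite E rootM root_XsubC => /orP[|/eqP]; [left|right].
rewrite finite_setU; split; last exact: finite_set1.
apply: (IH p _ p0); rewrite (leq_trans _ qn) // E size_Mmonic ?monicXsubC //.
by rewrite size_XsubC addn2.
Qed.

Definition moment t k := \int[leb]_(x in D) ('X^k.[x] * w t x).

Lemma Rintegral_horner_weight q t :
  \int[leb]_(x in D) (q.[x] * w t x) = moment_fun (moment t) q.
Proof.
suff H n : \int[leb]_(x in D) ((\sum_(i < n) q`_i *: 'X^i).[x] * w t x)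
    = \sum_(i < n) q`_i * moment t i.
  by rewrite -[in LHS](coefK q) poly_def H.
elim: n => [|n IH].
  rewrite !big_ord0 /Rintegral integral0_eq // => x _.
  by rewrite horner0 mul0r.
rewrite !big_ord_recr /= -IH /moment -RintegralZl //; last exact: integrable_horner_weight.
rewrite -RintegralD //; first last.
- apply: eq_integrable (integrable_horner_weight (q`_n *: 'X^n) t) => // x _.
  by rewrite /= hornerZ -mulrA.
- exact: (integrable_horner_weight (\sum_(i < n) q`_i *: 'X^i) t).
by apply: eq_Rintegral => x _; rewrite hornerD hornerZ mulrDl -mulrA.
Qed.

Lemma integral_horner_weight q t :
  (\int[leb]_(x in D) (q.[x] * w t x)%:E = (moment_fun (moment t) q)%:E)%E.
Proof.
rewrite -Rintegral_horner_weight /Rintegral fineK //.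
by apply: integrable_fin_num => //; exact: (integrable_horner_weight q t).
Qed.

(** Otherwise q^2 w, which is nonnegative, would vanish almost everywhere on
    the half-line; but its zeros there are the finitely many roots of q. *)
Lemma moment_fun_sqr_neq0 q t : q != 0 -> moment_fun (moment t) (q * q) != 0.
Proof.
move=> q0; apply/eqP => E.
have := integral_horner_weight (q * q) t; rewrite E.
under eq_integral => x _.
  rewrite -[(_ * _)%:E]gee0_abs; last first.
    by rewrite lee_fin hornerM mulr_ge0 ?weight_ge0 // -expr2 sqr_ge0.
  over.
have /measurable_EFinP mf := measurable_horner_weight (q * q) t.
move/(ae_eq_integral_abs leb _ mf) => /(_ (measurable_itv _))[N [mN N0 qN]].
have Z0 : leb [set x | root q x] = 0%E.
  by apply/countable_lebesgue_measure0/finite_set_countable/finite_roots.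
have mZ : measurable [set x | root q x].
  exact/countable_measurable/finite_set_countable/finite_roots.
have DNZ : D `<=` N `|` [set x | root q x].
  move=> x Dx; have [|nr] := pselect (root q x); [by right|left].
  apply: qN => /= /(_ Dx) [] /eqP; rewrite mulf_eq0 hornerM mulf_eq0.
  move: Dx; rewrite /= in_itv/= andbT => /(weight_gt0 t)/gt_eqF ->.
  by rewrite !orbF orbb => /nr.
have : (leb D <= leb (N `|` [set x | root q x]))%E.
  by apply: le_measure => //; rewrite inE //; exact: measurableU.
rewrite (null_set_setU mN mZ N0 Z0); have -> : leb D = +oo%E.
  by rewrite -[LHS]/(lebesgue_measure D) lebesgue_measure_itv /= ltry.
by [].
Qed.

Lemma is_derive_weight_t (t x : R) : is_derive t 1 (w ^~ x) (x * w t x).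
Proof.
rewrite /weight; apply: is_derive_eq; rewrite /GRing.scale /=; ring.
Qed.

Lemma weight_homo x t u : 0 <= x -> t <= u -> w t x <= w u x.
Proof.
by move=> x0 tu; rewrite ler_wpM2l ?powR_ge0 // ler_expR lerD2l ler_wpM2r.
Qed.

(** Differentiation under the integral sign: for u in the unit neighbourhood
    of t, the t-derivative x^(k+1) w(x;u) is dominated by its value at
    u = t + 1, because w is nondecreasing in t for x > 0. *)
Lemma is_derive_moment (t : R) k :
  is_derive t 1 (fun u => moment u k) (moment t k.+1).
Proof.
pose f u x := 'X^k.[x] * w u x.
have d1f u x : partial1of2 f u x = 'X^(k.+1).[x] * w u x.
  rewrite partial1of2E; apply: derive_val.
  apply: (is_derive_eq (is_deriveZ _ (is_derive_weight_t u x))).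
  by rewrite !hornerXn exprSr /GRing.scale /= mulrA.
have It : (`]t - 1, t + 1[%classic : set R) t.
  by rewrite /= in_itv /= ltrBlDr ltrDl ltr01.
have intf u : (`]t - 1, t + 1[%classic : set R) u ->
    leb.-integrable D (EFin \o f u).
  by move=> _; exact: integrable_horner_weight.
have df u x : (`]t - 1, t + 1[%classic : set R) u -> D x ->
    derivable (f ^~ x) u 1.
  move=> _ _; have -> : (f ^~ x) = 'X^k.[x] \*: (w ^~ x) by [].
  apply: derivableZ.
  exact: (@ex_derive _ _ _ _ _ _ _ (is_derive_weight_t _ _)).
pose G x := `|'X^(k.+1).[x] * w (t + 1) x|.
have G0 x : 0 <= G x by exact: normr_ge0.
have iG : leb.-integrable D (EFin \o G).
  by have := integrable_norm (integrable_horner_weight 'X^(k.+1) (t + 1)).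
have Gub u x : (`]t - 1, t + 1[%classic : set R) u -> D x ->
    `|partial1of2 f u x| <= G x.
  rewrite /= !in_itv /= andbT => /andP[_ /ltW ut] /ltW x0.
  rewrite d1f /G !(normrM _ (w _ _)) !(ger0_norm (weight_ge0 _ _)).
  rewrite ler_wpM2l ?normr_ge0 //.
  exact: weight_homo.
apply: DeriveDef.
  exact: (@derivable_under_integral _ _ _ leb f _ (measurable_itv _)
    _ _ _ It intf df G G0 iG Gub).
rewrite -derive1E.
rewrite (@differentiation_under_integral _ _ _ leb f _ (measurable_itv _)
  _ _ _ It intf df G G0 iG Gub).
by apply: eq_Rintegral => x _; exact: d1f.
Qed.

(** The derivative is multiplied by x so as to express it through the weight
    itself, without the exponent lambda - 1. *)
Lemma is_derive_weight_x t (x : R) : 0 < x -> exists2 dw : R,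
  is_derive x 1 (w t) dw & x * dw = (lambda + t * x - 2 * x ^+ 2) * w t x.
Proof.
move=> x0.
have DE : is_derive x 1 (fun y : R => expR (- y ^+ 2 + t * y))
    ((- (2 * x) + t) * expR (- x ^+ 2 + t * x)).
  by apply: is_derive_eq; rewrite /GRing.scale /=; ring.
exists (x `^ lambda * ((- (2 * x) + t) * expR (- x ^+ 2 + t * x))
  + expR (- x ^+ 2 + t * x) * (lambda * x `^ (lambda - 1))).
  exact: (is_deriveM (is_derive1_powR lambda x0) DE).
rewrite /weight -(mulr_powRB1 (ltW x0) lambda_gt0); ring.
Qed.

Lemma continuous_weight t x : 0 < x -> {for x, continuous (w t)}.
Proof.
move=> /(is_derive_weight_x t)[dw /(@ex_derive _ _ _ _ _ _ _) Dw _].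
exact/differentiable_continuous/derivable1_diffP.
Qed.

(** Since lambda > 0 the weight is continuous from the right at 0, where it
    vanishes. *)
Lemma weight_cvg0 t : w t x @[x --> 0^'+] --> w t 0.
Proof.
have -> : w t 0 = 0 * expR (- 0 ^+ 2 + t * 0).
  by rewrite /weight powR0 // gt_eqF.
apply: cvgM; first exact: powR_cvg0.
apply: cvg_at_right_filter; apply: (@cvg_comp _ _ _ _ expR); last exact: continuous_expR.
by apply: cvgD; [apply: cvgN; exact: exprn_continuous|exact: mulrl_continuous].
Qed.

Lemma pearson_weight q t :
  moment_fun (moment t)
    ('X * q^`() + ((lambda + 1) *: q + t *: ('X * q) - 2 *: ('X * ('X * q)))) = 0.
Proof.
set p := _ + _; pose F x := ('X * q).[x] * w t x.
apply: EFin_inj; rewrite -integral_horner_weight.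
have [C1 H1] := horner_weight_le p t; have [C2 H2] := horner_weight_le ('X * q) t.
apply: (@integral_derive_eq0 _ F _ (Num.max C1 C2)).
- move=> x x0; apply: le_trans (H1 x x0) _.
  by rewrite ler_wpM2r ?expR_ge0 // le_max lexx.
- move=> x x0; apply: le_trans (H2 x x0) _.
  by rewrite ler_wpM2r ?expR_ge0 // le_max lexx orbT.
- move=> x x0; have [dw Dw xdw] := is_derive_weight_x t x0.
  apply: (is_derive_eq (is_deriveM (is_derive_poly ('X * q) x) Dw)).
  move: (w t x) xdw => W xdw; rewrite /p derivM derivX mul1r /GRing.scale /=.
  rewrite !(hornerD, hornerN, hornerM, hornerZ, hornerX) mulrAC xdw; ring.
- move=> x; rewrite in_itv/= andbT => x0.
  by apply: cvgM; [exact: continuous_horner|exact: continuous_weight].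
- apply: cvgM; last exact: weight_cvg0.
  by apply: cvg_at_right_filter; exact: continuous_horner.
- apply: cvgM; last exact: weight_cvg0.
  by apply: cvg_at_right_filter; exact: continuous_horner.
- by rewrite /F hornerM hornerX !mul0r.
Qed.

End Weight.

(** * The sigma-forms of Painleve IV *)

Lemma is_derive_scale {R : realType} (f : R -> R) (df c s : R) :
  is_derive (c * s) 1 f df -> is_derive s 1 (fun u => f (c * u)) (c * df).
Proof.
move=> Df; have Dc : is_derive s 1 (fun u : R => c * u) c.
  by apply: is_derive_eq; rewrite /GRing.scale /= mulr1.
exact: (is_derive_eq (is_derive1_comp Df Dc) (mulrC _ _)).
Qed.

Section Sigma.
Context {R : realType} (lambda : R) (lambda_gt0 : 0 < lambda).
Context (P : nat -> R -> {poly R}) (h : nat -> R -> R).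
Hypothesis HP : monic_OPS lambda P h.
Local Notation mu := (moment lambda).
Local Notation alpha n t := (rec_alpha (P ^~ t) n).
Local Notation beta n t := (rec_beta (h ^~ t) n).
Local Notation sg := (sigma lambda P).

Let Pt_monic t n : P n t \is monic. Proof. by case: HP => /(_ n t)[]. Qed.
Let size_Pt t n : size (P n t) = n.+1. Proof. by case: HP => /(_ n t)[]. Qed.

Let Lt_PP t i j :
  moment_fun (mu t) (P i t * P j t) = h i t * (i == j)%:R.
Proof.
have -> : h i t * (i == j)%:R = h j t * (i == j)%:R.
  by have [->|] := eqVneq i j; rewrite ?mulr0.
case: HP => _ /(_ i j t) E; apply: EFin_inj; rewrite -E.
rewrite -(integral_horner_weight lambda_gt0).
by apply: eq_integral => x _; rewrite hornerM.
Qed.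

Let ht_neq0 t n : h n t != 0.
Proof.
have := Lt_PP t n n; rewrite eqxx mulr1 => <-.
by apply: (moment_fun_sqr_neq0 lambda_gt0); rewrite monic_neq0.
Qed.

Lemma sigmaE n s :
  sg n s = - 2 * subleading_coef (P ^~ (2 * s)) n - (n%:R + lambda) * (2 * s).
Proof. by []. Qed.

Lemma is_derive_sigma n (s : R) :
  is_derive s 1 (sg n) (4 * beta n (2 * s) - 2 * (n%:R + lambda)).
Proof.
have Dp : is_derive (2 * s) 1 (fun u => subleading_coef (P ^~ u) n)
    (- beta n (2 * s)).
  apply: (@is_derive_subleading_coef _ mu P h) => *.
  - exact: is_derive_moment.
  - exact: Pt_monic.
  - exact: size_Pt.
  - exact: Lt_PP.
  - exact: ht_neq0.
have D1 : is_derive s 1 (fun u : R => (n%:R + lambda) * (2 * u))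
    ((n%:R + lambda) * 2).
  by apply: is_derive_eq; rewrite /GRing.scale /=; ring.
have D2 := is_deriveB (is_deriveZ (- 2) (is_derive_scale Dp)) D1.
apply: (is_derive_eq D2); rewrite /GRing.scale /=.
move: (beta n (2 * s)) => b; ring.
Qed.

Lemma derive1_sigma n :
  (sg n)^`()%classic = fun s => 4 * beta n (2 * s) - 2 * (n%:R + lambda).
Proof.
by apply/funext => s; rewrite derive1E (@derive_val _ _ _ _ _ _ _ (is_derive_sigma n s)).
Qed.

Lemma is_derive_derive1_sigma n (s : R) :
  is_derive s 1 (sg n)^`()%classic
    (8 * (beta n (2 * s) * (alpha n (2 * s) - alpha n.-1 (2 * s)))).
Proof.
have Db : is_derive (2 * s) 1 (fun u => beta n u)
    (beta n (2 * s) * (alpha n (2 * s) - alpha n.-1 (2 * s))).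
  apply: (@is_derive_beta _ mu P h) => *.
  - exact: is_derive_moment.
  - exact: Pt_monic.
  - exact: size_Pt.
  - exact: Lt_PP.
  - exact: ht_neq0.
rewrite derive1_sigma.
have D2 := is_deriveB (is_deriveZ 4 (is_derive_scale Db))
  (is_derive_cst (2 * (n%:R + lambda)) s 1).
apply: (is_derive_eq D2); rewrite /GRing.scale /=.
move: (beta n (2 * s)) (alpha n (2 * s)) (alpha n.-1 (2 * s)) => b a c; ring.
Qed.

Lemma sigma_ode n s :
  sigma_PIV_at 0 (2 * lambda) (2 * n%:R + 2 * lambda) (sg n) s.
Proof.
have D1 := is_derive_sigma n s; have D2 := is_derive_derive1_sigma n s.
split; [exact: (@ex_derive _ _ _ _ _ _ _ D1)|exact: (@ex_derive _ _ _ _ _ _ _ D2)|].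
rewrite derive1E (@derive_val _ _ _ _ _ _ _ D2) derive1_sigma sigmaE.
set t := 2 * s.
have S1 := string_sub (Pt_monic t) (size_Pt t) (Lt_PP t) (ht_neq0 t)
  (fun q => pearson_weight lambda_gt0 q t) n.
have Q := string_quad (Pt_monic t) (size_Pt t) (Lt_PP t) (ht_neq0 t)
  (fun q => pearson_weight lambda_gt0 q t) n.
move: S1 Q; rewrite /t.
move: (beta n (2 * s)) (alpha n (2 * s)) (alpha n.-1 (2 * s)) (subleading_coef _ n) n%:R.
move=> b a c p N /eqP; rewrite addr_eq0 => /eqP -> Q.
apply/eqP; rewrite -subr_eq0; apply/eqP.
(* 64 beta_n times the difference of the two sides of string_quad *)
transitivity (64 * b * ((2 * b - N) ^+ 2 - lambda * (2 * b - N)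
   - b * (2 * a - 2 * s) * (2 * c - 2 * s))); first by ring.
by rewrite Q subrr mulr0.
Qed.

Lemma sigma_discrete n s : (1 <= n)%N -> discrete_sigma_PIV_at lambda sg n s.
Proof.
case: n => // n _; rewrite /discrete_sigma_PIV_at [n.+1.-1]/=.
set t := 2 * s.
have S1 := string_sub (Pt_monic t) (size_Pt t) (Lt_PP t) (ht_neq0 t)
  (fun q => pearson_weight lambda_gt0 q t) n.+1.
have Q := string_quad (Pt_monic t) (size_Pt t) (Lt_PP t) (ht_neq0 t)
  (fun q => pearson_weight lambda_gt0 q t) n.+1.
have E : sg n.+2 s = sg n.+1 s + (2 * alpha n.+1 t - t).
  by rewrite !sigmaE /rec_alpha -/t -(natr1 n.+1); ring.
have E' : sg n s = sg n.+1 s - (2 * alpha n t - t).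
  by rewrite !sigmaE /rec_alpha -/t -(natr1 n); ring.
rewrite {}E {}E' sigmaE -/t.
move: S1 Q; rewrite [n.+1.-1]/= {}/t.
move: (beta n.+1 (2 * s)) (alpha n.+1 (2 * s)) (alpha n (2 * s)).
move: (subleading_coef _ n.+1) n.+1%:R.
move=> p N b a c /eqP; rewrite addr_eq0 => /eqP -> Q.
apply/eqP; rewrite -subr_eq0; apply/eqP.
(* R_n + R_{n-1} + t is 2 a + 2 c - t *)
transitivity (2 * (2 * a + 2 * c - 2 * s) ^+ 2
   * ((2 * b - N) ^+ 2 - lambda * (2 * b - N)
   - b * (2 * a - 2 * s) * (2 * c - 2 * s))); first by ring.
by rewrite Q subrr mulr0.
Qed.

End Sigma.

Theorem theorem1p5 (R : realType) (lambda : R) (lambda_gt0 : 0 < lambda)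
    (P : nat -> R -> {poly R}) (h : nat -> R -> R)
    (HP : monic_OPS lambda P h) :
  (forall (n : nat) (s : R),
     sigma_PIV_at 0 (2 * lambda) (2 * n%:R + 2 * lambda)
       (sigma lambda P n) s) /\
  (forall (n : nat) (s : R), (1 <= n)%N ->
     discrete_sigma_PIV_at lambda (sigma lambda P) n s).
Proof.
split=> n s; first exact: (sigma_ode lambda_gt0 HP).
exact: (sigma_discrete lambda_gt0 HP).
Qed.
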